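(* Let $w\in\mathrm{Br}_3$ be positive. Then every root of $\Delta_{\widehat{w}}$ in $\overline{\mathbb{D}}=\{z\in\mathbb{C}:|z|\le1\}$ is a point where $\rho_w=1$; that is, $(Z_w\cap\overline{\mathbb{D}})\subset R_w$. Moreover, the function $\rho_w(t)$ is continuous and subharmonic on $\mathbb{C}$; in fact, $\log(\rho_w(t))$ is subharmonic.
   Context: $\mathrm{Br}_3 = \langle \sigma_1, \sigma_2 \mid \sigma_1\sigma_2\sigma_1 = \sigma_2\sigma_1\sigma_2\rangle$ is the 3-strand braid group; $w$ is positive if it is a product of positive powers of $\sigma_1,\sigma_2$; $\widehat{w}$ is its braid closure. The reduced Burau representation $B_t : \mathrm{Br}_3 \to \mathrm{GL}_2(\mathbb{Z}[t^{\pm1}])$ is given by $B_t(\sigma_1) = \begin{pmatrix} -t & 1\\ 0 & 1\end{pmatrix}$, $B_t(\sigma_2) = \begin{pmatrix} 1 & 0 \\ t & -t\end{pmatrix}$. For a positive braid $w$ the entries of $B_t(w)$ are polynomials in $t$, and for $t\in\mathbb{C}$, $\rho_w(t)$ is the spectral radius (largest absolute value of an eigenvalue) of $B_t(w)$. $R_w=\{z\in\overline{\mathbb{D}}:\rho_w(z)=1\}$. The Alexander polynomial is $\Delta_{\widehat{w}}(t)=\det(B_t(w)-I)/(t^2+t+1)$, well defined up to units $\pm t^k$; by convention $0$ is a root of $\Delta_{\widehat w}$ only if $\Delta_{\widehat w}=0$. $Z_w=\{z\in\mathbb{C}:\Delta_{\widehat{w}}(z)=0\}$. Subharmonic functions take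 values in $[-\infty,\infty)$, with $\log 0=-\infty$. *)

(* Defs.v *)
From HB Require Import structures.
From mathcomp Require Import all_boot all_order all_algebra.
From mathcomp Require Import generic_quotient fraction complex.
From mathcomp Require Import all_classical all_reals all_analysis.
From mathcomp Require Import ring.

Set Implicit Arguments.
Unset Strict Implicit.
Unset Printing Implicit Defensive.

Import Order.TTheory GRing.Theory Num.Theory numFieldNormedType.Exports.

Local Open Scope classical_set_scope.
Local Open Scope ring_scope.
Local Open Scope quotient_scope.
Local Open Scope complex_scope.

(** * The braid group Br_3 *)

(* The letter (i, false) stands for sigma_{i+1}, (i, true) for its inverse. *)
Definition braid_letter := ('I_2 * bool)%type.
Definition braid_word := seq braid_letter.

Definition flip_letter (l : braid_letter) : braid_letter := (l.1, ~~ l.2).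

(* The congruence on words defining the group
   < s_1, s_2 | s_1 s_2 s_1 = s_2 s_1 s_2 >. *)
Inductive braid_rel : braid_word -> braid_word -> Prop :=
| braid_refl s : braid_rel s s
| braid_sym s1 s2 : braid_rel s1 s2 -> braid_rel s2 s1
| braid_trans s1 s2 s3 :
    braid_rel s1 s2 -> braid_rel s2 s3 -> braid_rel s1 s3
| braid_cat s1 s2 s1' s2' :
    braid_rel s1 s1' -> braid_rel s2 s2' -> braid_rel (s1 ++ s2) (s1' ++ s2')
| braid_cancel l : braid_rel [:: l; flip_letter l] [::]
| braid_braid :
    braid_rel [:: (ord0, false); (ord_max, false); (ord0, false)]
              [:: (ord_max, false); (ord0, false); (ord_max, false)].

Definition braid_relb : rel braid_word := fun s1 s2 => `[< braid_rel s1 s2 >].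

Lemma braid_relb_refl : reflexive braid_relb.
Proof. by move=> s; apply/asboolP/braid_refl. Qed.

Lemma braid_relb_sym : symmetric braid_relb.
Proof. by move=> s1 s2; apply/asboolP/asboolP; exact: braid_sym. Qed.

Lemma braid_relb_trans : transitive braid_relb.
Proof.
by move=> s2 s1 s3 /asboolP h /asboolP h'; apply/asboolP/(braid_trans h h').
Qed.

Canonical braid_equiv :=
  EquivRel braid_relb braid_relb_refl braid_relb_sym braid_relb_trans.

Definition Br3 := {eq_quot braid_equiv}.
HB.instance Definition _ : EqQuotient _ braid_equiv Br3 := EqQuotient.on Br3.
HB.instance Definition _ := Choice.on Br3.

Definition braid_of (s : braid_word) : Br3 := \pi_Br3 s.

Lemma braid_ofP s1 s2 : reflect (braid_rel s1 s2) (braid_of s1 == braid_of s2).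
Proof. by rewrite /braid_of eqmodE; exact: asboolP. Qed.

Lemma braid_of_eq s1 s2 : braid_rel s1 s2 -> braid_of s1 = braid_of s2.
Proof. by move=> h; apply/eqP/braid_ofP. Qed.

Lemma braid_ofK (w : Br3) : braid_of (repr w) = w.
Proof. exact: reprK. Qed.

Lemma repr_braid_of s : braid_rel (repr (braid_of s)) s.
Proof. by apply/braid_ofP; rewrite braid_ofK. Qed.

Definition flip_word (s : braid_word) : braid_word := rev (map flip_letter s).

Definition braid_one : Br3 := braid_of [::].
Definition braid_mul (w1 w2 : Br3) : Br3 := braid_of (repr w1 ++ repr w2).
Definition braid_inv (w : Br3) : Br3 := braid_of (flip_word (repr w)).

Lemma flip_letterK : involutive flip_letter.
Proof. by case=> i b; rewrite /flip_letter /= negbK. Qed.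

Lemma flip_wordK : involutive flip_word.
Proof.
by move=> s; rewrite /flip_word map_rev revK -map_comp (eq_map flip_letterK) map_id.
Qed.

Lemma braid_rel_flip s : braid_rel (s ++ flip_word s) [::].
Proof.
elim: s => [|l s IH]; first exact: braid_refl.
rewrite /flip_word /= rev_cons -cats1 catA -/(flip_word s).
apply: braid_trans (braid_cancel l).
exact: (braid_cat (braid_refl [:: l]) (braid_cat IH (braid_refl [:: flip_letter l]))).
Qed.

Lemma braid_of_cat s1 s2 : braid_of (s1 ++ s2) = braid_mul (braid_of s1) (braid_of s2).
Proof. by apply/braid_of_eq/braid_sym/braid_cat; exact: repr_braid_of. Qed.

Lemma braid_mulA : associative braid_mul.
Proof.
move=> w1 w2 w3; rewrite -(braid_ofK w1) -(braid_ofK w2) -(braid_ofK w3).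
by rewrite -!braid_of_cat catA.
Qed.

Lemma braid_mul1g : left_id braid_one braid_mul.
Proof. by move=> w; rewrite -(braid_ofK w) -braid_of_cat. Qed.

Lemma braid_mulg1 : right_id braid_one braid_mul.
Proof. by move=> w; rewrite -(braid_ofK w) -braid_of_cat cats0. Qed.

Lemma braid_mulgV : right_inverse braid_one braid_inv braid_mul.
Proof.
move=> w; rewrite -{1}(braid_ofK w) -braid_of_cat.
exact/braid_of_eq/braid_rel_flip.
Qed.

Lemma braid_mulVg : left_inverse braid_one braid_inv braid_mul.
Proof.
move=> w; rewrite -{2}(braid_ofK w) -braid_of_cat.
rewrite -{2}(flip_wordK (repr w)).
exact/braid_of_eq/braid_rel_flip.
Qed.

HB.instance Definition _ := isGroup.Build Br3
  braid_mulA braid_mul1g braid_mulg1 braid_mulVg braid_mulgV.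

Definition sigma (i : 'I_2) : Br3 := braid_of [:: (i, false)].

Definition positive_braid (w : Br3) : Prop :=
  exists s : seq 'I_2, w = (\prod_(i <- s) sigma i)%g.

(** * The reduced Burau representation *)

Section BurauMatrices.
Variables (A : nzRingType) (t : A).

Definition mx2 (a b c d : A) : 'M[A]_2 :=
  \matrix_(i, j) (if i == 0 then (if j == 0 then a else b)
                  else (if j == 0 then c else d)).

Definition burau_gen (i : 'I_2) : 'M[A]_2 :=
  if i == 0 then mx2 (- t) 1 0 1 else mx2 1 0 t (- t).

End BurauMatrices.

(* The ring Z[t, t^-1] is realized inside the fraction field of Z[t]; see
   burau_laurent below. *)
Notation Qt := {fraction {poly int}}.

Definition tvar : Qt := tofrac 'X.

Definition burau_letter (l : braid_letter) : 'M[Qt]_2 :=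
  if l.2 then (burau_gen tvar l.1)^-1 else burau_gen tvar l.1.

Definition burau_word (s : braid_word) : 'M[Qt]_2 := \prod_(l <- s) burau_letter l.

Definition burau (w : Br3) : 'M[Qt]_2 := burau_word (repr w).

Lemma detmx2 (A : comNzRingType) (M : 'M[A]_2) :
  \det M = M ord0 ord0 * M ord_max ord_max - M ord0 ord_max * M ord_max ord0.
Proof.
rewrite (expand_det_row _ ord0) !big_ord_recl big_ord0 addr0 /cofactor !det_mx11 !mxE /=.
rewrite expr0 expr1 mul1r mulN1r mulrN.
by congr (M _ _ * M _ _ - M _ _ * M _ _); exact/val_inj.
Qed.

Lemma matrix2P (A : Type) (M N : 'M[A]_2) :
  M ord0 ord0 = N ord0 ord0 -> M ord0 ord_max = N ord0 ord_max ->
  M ord_max ord0 = N ord_max ord0 -> M ord_max ord_max = N ord_max ord_max ->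
  M = N.
Proof.
move=> h1 h2 h3 h4; apply/matrixP => i j.
have o2 (k : 'I_2) : k = ord0 \/ k = ord_max.
  by case: k => -[|[|k]] // hk; [left|right]; exact/val_inj.
by case: (o2 i) => ->; case: (o2 j) => ->.
Qed.

Lemma mulmx2E (A : nzRingType) (M N : 'M[A]_2) i j :
  (M * N) i j = M i ord0 * N ord0 j + M i ord_max * N ord_max j.
Proof.
rewrite !mxE !big_ord_recl big_ord0 addr0.
by congr (_ + M _ _ * N _ _); exact/val_inj.
Qed.

Lemma det_burau_gen (A : comNzRingType) (t : A) i : \det (burau_gen t i) = - t.
Proof.
by rewrite detmx2 /burau_gen; case: ifP => _; rewrite !mxE /=; ring.
Qed.

Lemma tvar_neq0 : tvar != 0.
Proof. by rewrite /tvar tofrac_eq0 polyX_eq0. Qed.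

Lemma burau_gen_unit i : burau_gen tvar i \is a GRing.unit.
Proof. by rewrite unitmxE det_burau_gen unitfE oppr_eq0 tvar_neq0. Qed.

Lemma burau_letter_unit l : burau_letter l \is a GRing.unit.
Proof.
by rewrite /burau_letter; case: ifP => _; rewrite ?unitrV burau_gen_unit.
Qed.

Lemma burau_word_cat s1 s2 : burau_word (s1 ++ s2) = burau_word s1 * burau_word s2.
Proof. exact: big_cat. Qed.

Lemma burau_gen_braid (A : comNzRingType) (t : A) :
  burau_gen t ord0 * burau_gen t ord_max * burau_gen t ord0 =
  burau_gen t ord_max * burau_gen t ord0 * burau_gen t ord_max.
Proof.
by apply: matrix2P; rewrite !mulmx2E !mxE /=; ring.
Qed.

Lemma prod3 (A : nzRingType) (I : Type) (F : I -> A) a b c :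
  \prod_(l <- [:: a; b; c]) F l = F a * F b * F c.
Proof. by rewrite !big_cons big_nil mulr1 mulrA. Qed.

Lemma burau_word_rel s1 s2 : braid_rel s1 s2 -> burau_word s1 = burau_word s2.
Proof.
elim => // {s1 s2}.
- by move=> s1 s2 s3 _ -> _ ->.
- by move=> s1 s2 s1' s2' _ h1 _ h2; rewrite !burau_word_cat h1 h2.
- move=> [i b]; rewrite /burau_word !big_cons !big_nil mulr1 /burau_letter /=.
  by case: b => /=; rewrite ?mulVr ?mulrV ?burau_gen_unit.
- have hl i : burau_letter (i, false) = burau_gen tvar i by [].
  rewrite /burau_word !prod3 !hl.
  exact: burau_gen_braid.
Qed.

Lemma burau_braid_of s : burau (braid_of s) = burau_word s.
Proof. exact/burau_word_rel/repr_braid_of. Qed.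

Lemma burau_sigma i : burau (sigma i) = burau_gen tvar i.
Proof. by rewrite burau_braid_of /burau_word big_seq1. Qed.

Lemma burau1 : burau 1%g = 1.
Proof. by rewrite burau_braid_of /burau_word big_nil. Qed.

Lemma burauM w1 w2 : burau (w1 * w2)%g = burau w1 * burau w2.
Proof.
by rewrite -(braid_ofK w1) -(braid_ofK w2) -[(_ * _)%g]braid_of_cat
  !burau_braid_of burau_word_cat.
Qed.

Lemma unitr_prod_seq (A : unitRingType) (I : Type) (F : I -> A) s :
  (forall l, F l \is a GRing.unit) -> \prod_(l <- s) F l \is a GRing.unit.
Proof.
move=> h; elim: s => [|l s IH]; first by rewrite big_nil unitr1.
by rewrite big_cons unitrMl.
Qed.

Lemma burau_unit w : burau w \is a GRing.unit.
Proof.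
by apply: unitr_prod_seq => l; exact: burau_letter_unit.
Qed.

Definition laurent : {pred Qt} :=
  fun f => `[< exists n (p : {poly int}), f * tvar ^+ n = tofrac p >].

Lemma laurentP f :
  reflect (exists n (p : {poly int}), f * tvar ^+ n = tofrac p) (f \in laurent).
Proof. exact: asboolP. Qed.

Lemma laurent_tofrac p : tofrac p \in laurent.
Proof. by apply/laurentP; exists 0%N, p; rewrite expr0 mulr1. Qed.

Lemma laurent_tvarV : tvar^-1 \in laurent.
Proof.
by apply/laurentP; exists 1%N, 1; rewrite expr1 mulVf ?tvar_neq0 // tofrac1.
Qed.

Lemma laurent_subring : subring_closed laurent.
Proof.
split; first by rewrite -tofrac1 laurent_tofrac.
- move=> f g /laurentP[n [p hp]] /laurentP[m [q hq]]; apply/laurentP.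
  exists (n + m)%N, (p * 'X^m - q * 'X^n).
  rewrite tofracB !tofracM !tofracXn -hp -hq exprD -/tvar mulrBl.
  by rewrite -!mulrA [tvar ^+ m * _]mulrC.
- move=> f g /laurentP[n [p hp]] /laurentP[m [q hq]]; apply/laurentP.
  exists (n + m)%N, (p * q).
  by rewrite tofracM -hp -hq exprD mulrACA.
Qed.

HB.instance Definition _ := GRing.isSubringClosed.Build Qt laurent laurent_subring.

Lemma laurent_tvar : tvar \in laurent.
Proof. exact: laurent_tofrac. Qed.

Definition burau_genV (F : fieldType) (t : F) (i : 'I_2) : 'M[F]_2 :=
  if i == 0 then mx2 (- t^-1) t^-1 0 1 else mx2 1 0 1 (- t^-1).

Lemma burau_genVE (F : fieldType) (t : F) (i : 'I_2) :
  t != 0 -> (burau_gen t i)^-1 = burau_genV t i.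
Proof.
move=> t0; have gU : burau_gen t i \is a GRing.unit.
  by rewrite unitmxE det_burau_gen unitfE oppr_eq0.
suff h : burau_gen t i * burau_genV t i = 1.
  by rewrite -[RHS](mulKr gU) h mulr1.
rewrite /burau_gen /burau_genV.
by case: ifP => _; apply: matrix2P; rewrite mulmx2E !mxE /=; field.
Qed.

Lemma burau_letterE l : burau_letter l =
  if l.2 then burau_genV tvar l.1 else burau_gen tvar l.1.
Proof. by rewrite /burau_letter burau_genVE ?tvar_neq0. Qed.

Lemma burau_letter_laurent l i j : burau_letter l i j \in laurent.
Proof.
have [ht hV] := (laurent_tvar, laurent_tvarV).
rewrite burau_letterE /burau_genV /burau_gen.
by case: ifP => _; case: ifP => _; rewrite mxE; do 2! case: ifP => _;
  rewrite ?rpredN ?rpred0 ?rpred1.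
Qed.

Lemma burau_laurent w i j : burau w i j \in laurent.
Proof.
rewrite /burau /burau_word; elim: (repr w) i j => [|l s IH] i j.
  by rewrite big_nil mxE; case: (_ == _); rewrite ?rpred0 ?rpred1.
by rewrite big_cons mulmx2E rpredD // rpredM // burau_letter_laurent.
Qed.

(* The polynomial equal to f (0 if f is not a polynomial). *)
Definition poly_of (f : Qt) : {poly int} := xget 0 [set p | tofrac p = f].

Lemma tofracK : cancel (@tofrac {poly int}) poly_of.
Proof.
move=> p; rewrite /poly_of; case: xgetP => [q _ /= /eqP|/(_ p)]; last by case.
by rewrite tofrac_eq => /eqP.
Qed.

Definition burau_poly (w : Br3) : 'M[{poly int}]_2 := map_mx poly_of (burau w).

Lemma map_burau_gen i : map_mx (@tofrac {poly int}) (burau_gen ('X : {poly int}) i) = burau_gen tvar i.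
Proof.
rewrite /burau_gen; case: ifP => _; apply: matrix2P;
  by rewrite !mxE /= ?tofracN ?tofrac1 ?tofrac0.
Qed.

Lemma burau_prod_sigma (s : seq 'I_2) :
  burau (\prod_(i <- s) sigma i)%g =
  map_mx (@tofrac {poly int}) (\prod_(i <- s) burau_gen ('X : {poly int}) i).
Proof.
elim: s => [|i s IH]; first by rewrite !big_nil burau1 map_mx1.
by rewrite !big_cons burauM IH burau_sigma -map_burau_gen map_mxM.
Qed.

Lemma burau_poly_prod_sigma (s : seq 'I_2) :
  burau_poly (\prod_(i <- s) sigma i)%g = \prod_(i <- s) burau_gen 'X i.
Proof.
rewrite /burau_poly burau_prod_sigma -map_mx_comp; apply/matrixP => i j.
by rewrite mxE /= tofracK.
Qed.

Lemma burau_polyP w : positive_braid w -> map_mx (@tofrac {poly int}) (burau_poly w) = burau w.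
Proof. by case=> s ->; rewrite burau_poly_prod_sigma burau_prod_sigma. Qed.

(** * The Alexander polynomial of the closure *)

Definition cyclo3 (A : nzRingType) (t : A) : A := t ^+ 2 + t + 1.

Definition alexander (w : Br3) : Qt :=
  \det (burau w - 1) / cyclo3 tvar.

(* As alexander w is only meaningful up to units +- t^k, its roots are those
   of the representative that is an honest polynomial with nonzero constant
   term (or 0). *)
Definition alexander_rep (w : Br3) (p : {poly int}) : Prop :=
  (p = 0 \/ p`_0 != 0) /\
  exists (e : bool) (k : int), tofrac p = (-1) ^+ e * tvar ^ k * alexander w.

Definition alexander_poly (w : Br3) : {poly int} := xget 0 (alexander_rep w).

Lemma cyclo3_neq0 : cyclo3 tvar != 0.
Proof.
rewrite /cyclo3 /tvar -tofrac1 -tofracXn -!tofracD tofrac_eq0.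
apply/eqP => /(congr1 (fun p : {poly int} => p.[0])).
by rewrite !hornerE.
Qed.

(* M (1, 1 + t)^T = (1, 1 + t)^T + (t^2 + t + 1) (c1, c2)^T *)
Definition fixes_mod (A : comNzRingType) (t : A) (M : 'M[A]_2) (c1 c2 : A) :=
  M ord0 ord0 + M ord0 ord_max * (1 + t) = 1 + cyclo3 t * c1 /\
  M ord_max ord0 + M ord_max ord_max * (1 + t) = 1 + t + cyclo3 t * c2.

Lemma fixes_mod1 (A : comNzRingType) (t : A) : fixes_mod t 1 0 0.
Proof. by split; rewrite !mxE /=; ring. Qed.

Lemma fixes_modM (A : comNzRingType) (t : A) (M N : 'M[A]_2) c1 c2 d1 d2 :
  fixes_mod t M d1 d2 -> fixes_mod t N c1 c2 ->
  fixes_mod t (M * N) (d1 + M ord0 ord0 * c1 + M ord0 ord_max * c2)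
                      (d2 + M ord_max ord0 * c1 + M ord_max ord_max * c2).
Proof.
case=> k1 k2 [h1 h2].
have aux (x y : A) :
    x * N ord0 ord0 + y * N ord_max ord0 +
    (x * N ord0 ord_max + y * N ord_max ord_max) * (1 + t) =
    (x + y * (1 + t)) + cyclo3 t * (x * c1 + y * c2).
  transitivity (x * (N ord0 ord0 + N ord0 ord_max * (1 + t)) +
    y * (N ord_max ord0 + N ord_max ord_max * (1 + t))); first by ring.
  by rewrite h1 h2; ring.
by split; rewrite !mulmx2E aux ?k1 ?k2; ring.
Qed.

Lemma fixes_mod_gen (A : comNzRingType) (t : A) i :
  fixes_mod t (burau_gen t i) 0 (if i == 0 then 0 else - 1).
Proof.
by split; rewrite /burau_gen /cyclo3; case: ifP => _; rewrite !mxE /=; ring.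
Qed.

Lemma fixes_mod_genV (F : fieldType) (t : F) i : t != 0 ->
  fixes_mod t (burau_genV t i) 0 (if i == 0 then 0 else - t^-1).
Proof.
move=> t0; split; rewrite /burau_genV /cyclo3; case: ifP => _;
  by rewrite !mxE /=; field.
Qed.

Lemma fixes_mod_det (F : fieldType) (t : F) (M : 'M[F]_2) c1 c2 :
  cyclo3 t != 0 -> fixes_mod t M c1 c2 ->
  \det (M - 1) / cyclo3 t = c1 * (M ord_max ord_max - 1) - c2 * M ord0 ord_max.
Proof.
move=> q0 [/(canRL (addrK _)) h1 /(canRL (addrK _)) h2].
apply: (canLR (mulfK q0)); rewrite detmx2 !mxE /= !subr0 h1 h2.
by ring.
Qed.

Lemma burau_fixed w : exists c1 c2 : Qt,
  [/\ c1 \in laurent, c2 \in laurent & fixes_mod tvar (burau w) c1 c2].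
Proof.
rewrite /burau /burau_word; elim: (repr w) => [|l s [c1 [c2 [l1 l2 h]]]].
  by exists 0, 0; rewrite big_nil rpred0; split => //; exact: fixes_mod1.
have [d1 [d2 [m1 m2 k]]] : exists d1 d2 : Qt,
    [/\ d1 \in laurent, d2 \in laurent & fixes_mod tvar (burau_letter l) d1 d2].
  exists 0, (if l.1 == 0 then 0 else if l.2 then - tvar^-1 else - 1).
  rewrite rpred0 burau_letterE; split=> //.
    by case: ifP => _; [|case: ifP => _];
      rewrite ?rpredN ?rpred0 ?rpred1 ?laurent_tvarV.
  case: (l.2); first exact: fixes_mod_genV tvar_neq0.
  exact: fixes_mod_gen.
have L := burau_letter_laurent l.
rewrite big_cons; eexists; eexists; split; last exact: (fixes_modM k h).
- by apply: rpredD; [apply: rpredD => //|]; apply: rpredM.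
- by apply: rpredD; [apply: rpredD => //|]; apply: rpredM.
Qed.

Lemma alexander_laurent w : alexander w \in laurent.
Proof.
have [c1 [c2 [l1 l2 h]]] := burau_fixed w.
rewrite /alexander (fixes_mod_det cyclo3_neq0 h).
by rewrite rpredB // rpredM // ?rpredB ?rpred1 // burau_laurent.
Qed.

Lemma mulf_exprz_sub (F : fieldType) (t f : F) (n m : nat) :
  t != 0 -> t ^ (n%:Z - m%:Z) * f * t ^+ m = f * t ^+ n.
Proof.
move=> t0; rewrite expfzDr // -exprnN -!exprnP.
by rewrite mulrAC mulfVK ?expf_neq0 // mulrC.
Qed.

Lemma alexander_polyP w : alexander_rep w (alexander_poly w).
Proof.
apply: (@xgetPex _ 0 (alexander_rep w)).
have /laurentP[n [p hp]] := alexander_laurent w.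
have t0 := tvar_neq0.
have [p0|p_neq0] := eqVneq p 0.
  exists 0; split; first by left.
  exists false, 0; move/eqP: hp; rewrite p0 tofrac0 mulf_eq0 expf_eq0 (negbTE t0) andbF orbF.
  by move=> /eqP ->; rewrite mulr0.
have [m [q]] := multiplicity_XsubC p 0.
rewrite p_neq0 /= polyC0 subr0 => q0 pE.
exists q; split; first by right; rewrite -horner_coef0.
exists false, (n%:Z - m%:Z); rewrite expr0 mul1r.
apply: (mulIf (expf_neq0 m t0)); rewrite (mulf_exprz_sub _ _ _ t0) hp pE.
by rewrite tofracM tofracXn.
Qed.

Section Complex.
Variable R : realType.

Definition ceval (p : {poly int}) (z : R[i]) : R[i] := (map_poly intr p).[z].

Definition burau_at (w : Br3) (z : R[i]) : 'M[R[i]]_2 :=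
  map_mx (fun p => ceval p z) (burau_poly w).

Definition spectral_radius n (A : 'M[R[i]]_n) : R :=
  sup [set Normc.normc a | a in [set a | eigenvalue A a]].

Lemma spectral_radiusP n (A : 'M[R[i]]_n.+1) :
  (exists2 a, eigenvalue A a & Normc.normc a = spectral_radius A) /\
  (forall a, eigenvalue A a -> Normc.normc a <= spectral_radius A).
Proof.
set f := @Normc.normc R.
have [rs rsE] := closed_field_poly_normal (char_poly A).
have evE a : eigenvalue A a = (a \in rs).
  rewrite eigenvalue_root_char rsE rootZ ?root_prod_XsubC //.
  by rewrite (monicP (char_poly_monic A)) oner_neq0.
have maxP (s : seq R[i]) : s != [::] ->
    exists2 r, r \in s & forall a, a \in s -> f a <= f r.
  elim: s => // x [|y s] IH _.
    by exists x; [rewrite inE|move=> a; rewrite inE => /eqP ->].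
  have [//|r rs' hr] := IH.
  have [xr|rx] := leP (f x) (f r).
    by exists r; [rewrite inE rs' orbT|move=> a; rewrite inE => /predU1P[->//|/hr]].
  exists x; first by rewrite inE eqxx.
  by move=> a; rewrite inE => /predU1P[->//|/hr /le_trans]; apply; exact: ltW.
have rs0 : rs != [::].
  apply/eqP => rs0; have := size_char_poly A; rewrite rsE rs0 big_nil.
  by rewrite (monicP (char_poly_monic A)) scale1r size_poly1.
have [r rrs hr] := maxP rs rs0.
suff -> : spectral_radius A = f r.
  by split; [exists r; rewrite ?evE|move=> a; rewrite evE; exact: hr].
apply/eqP; rewrite eq_le; apply/andP; split.
  apply: ge_sup; first by exists (f r), r => //=; rewrite evE.
  by move=> _ [a /= + <-]; rewrite evE; exact: hr.
apply: ub_le_sup; last by exists r => //=; rewrite evE.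
by exists (f r) => _ [a /= + <-]; rewrite evE; exact: hr.
Qed.

Definition rho (w : Br3) (z : R[i]) : R := spectral_radius (burau_at w z).

Definition closed_unit_disc : set R[i] := [set z | `|z| <= 1].

Definition Rset (w : Br3) : set R[i] := [set z | closed_unit_disc z /\ rho w z = 1].

Definition Zset (w : Br3) : set R[i] := [set z | ceval (alexander_poly w) z = 0].

(* R[i]^o carries the usual topology, i.e. that of the complex modulus. *)
Definition subharmonic (u : R[i] -> \bar R) : Prop :=
  [/\ forall z, (u z < +oo)%E,
      lower_semicontinuous ((fun z => - u z)%E : R[i]^o -> \bar R) &
      forall (z : R[i]) (r : R), 0 < r ->
        (u z <= ((2 * pi)^-1)%:E *
          \int[lebesgue_measure]_(theta in `[0%R, (2 * pi)%R])
             u (z + (r * cos theta +i* (r * sin theta)))%R)%E].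

End Complex.

Arguments closed_unit_disc R : clear implicits.
Arguments Rset R w : clear implicits.
Arguments Zset R w : clear implicits.

(* Main.v *)
Require Import Defs.
From HB Require Import structures.
From mathcomp Require Import all_boot all_order all_algebra.
From mathcomp Require Import generic_quotient fraction complex.
From mathcomp Require Import all_classical all_reals all_analysis.
From mathcomp Require Import ring lra.

Import Order.TTheory GRing.Theory Num.Theory numFieldNormedType.Exports.

Local Open Scope classical_set_scope.
Local Open Scope ring_scope.

(** Let tau and delta be the trace and determinant of the Burau matrix B(z) of a
positive braid; both are polynomials in z, and delta = (-z)^n.

_Roots of the Alexander polynomial._ At such a root z the number 1 is an
eigenvalue of B(z): clearing the denominators of Delta leaves an identity
Delta * (t^2+t+1) * t^a = +- t^b * det (B - I) of polynomials, and z is nonzero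
unless Delta = 0 (lemma [det_burau_at_sub1]). The other eigenvalue is delta,
whose modulus |z|^n is at most 1 in the closed disc, so the spectral radius
is 1 ([spectral_radius_eq1]).

_Continuity._ If a, b are the eigenvalues, then |a|^2 + |b|^2 and |a|^2 |b|^2
are continuous functions of tau and delta, by the parallelogram law applied to
(a + b)^2 = tau^2 and (a - b)^2 = tau^2 - 4 delta. So rho^2, the larger of |a|^2
and |b|^2, is given by the quadratic formula ([spectral_radius2E]).

_Subharmonicity._ Everything rests on one weak form of Jensen's inequality
([log_norm_poly_le_mean]): if p is a polynomial and log |p| <= L on the circle of
centre z and radius r, with L continuous, then log |p(z)| is at most the mean of
L. It is proved without locating the zeros of p. For the N-th roots of unity
omega^k, the polynomial P(x) = prod_k p(z + r omega^k x) satisfies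
P(0) = p(z)^N, so |P(x)| >= |p(z)|^N for some x on the unit circle, which says
that a Riemann sum of L over N equally spaced points is at least log |p(z)|. By
uniform continuity these Riemann sums converge to the mean of L however the
points are rotated ([riemann_sum_le]).

The inequality is applied to the power sums p_m = a^m + b^m, polynomials in tau
and delta, hence in z. On the circle |p_m| <= 2 rho^m <= 2 (rho + e)^m for every
e > 0, while |p_m(z)| >= rho(z)^m / 2 for arbitrarily large m
([power_sum_ge]); dividing logarithms by m and letting m grow gives
log rho(z) <= mean of log (rho + e) ([log_spectral_radius_le_mean]). Adding e
keeps the majorant continuous where rho vanishes. As e decreases to 0, monotone
convergence yields the inequality for log rho ([integral_lne_ge]), and bounding
log by its tangent at rho(z) yields the one for rho ([integral_ge_of_log]). *)

Section SpectralRadius.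
Variable R : realType.

Local Open Scope complex_scope.
Local Notation normc := Normc.normc.
Local Notation mu := (@lebesgue_measure R).

(** * Maximum modulus on the unit circle *)

Definition cis (t : R) : R[i] := cos t +i* sin t.

Lemma cis0 : cis 0 = 1.
Proof. by rewrite /cis cos0 sin0. Qed.

Lemma cisD a b : cis (a + b) = cis a * cis b.
Proof.
by rewrite /cis cosD sinD; apply/eqP; rewrite eq_complex/= addrC eqxx/= addrC eqxx.
Qed.

Lemma cisMn a n : cis (a *+ n) = cis a ^+ n.
Proof.
by elim: n => [|n IH]; rewrite ?cis0 // mulrSr cisD IH exprSr.
Qed.

Lemma cis2pi : cis (pi *+ 2) = 1.
Proof. by rewrite /cis cos2pi sin2pi. Qed.

Lemma cis_neq1 a : 0 < a < pi *+ 2 -> cis a != 1.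
Proof.
move=> /andP[a0 a2]; rewrite eq_complex/= negb_and; apply/orP; left.
have -> : a = (a / 2) *+ 2 by rewrite -mulr_natr divfK.
rewrite cos_mulr2n cos2sin2 mulrnBl.
have s : 0 < sin (a / 2) by apply: sin_gt0_pi; rewrite divr_gt0//= ltr_pdivrMr// mulr_natr.
by apply/eqP; have := exprn_gt0 2 s; lra.
Qed.

Lemma normc_ge0 (x : R[i]) : 0 <= normc x.
Proof. by case: x => a b; exact: sqrtr_ge0. Qed.

Lemma normc_sum n (F : 'I_n -> R[i]) : normc (\sum_(i < n) F i) <= \sum_(i < n) normc (F i).
Proof.
elim/big_ind2 : _ => //; first by rewrite Normc.normc0.
by move=> x1 x2 y1 y2 h1 h2; rewrite (le_trans (le_normcD _ _))// lerD.
Qed.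

Lemma normc_prod n (F : 'I_n -> R[i]) : normc (\prod_(i < n) F i) = \prod_(i < n) normc (F i).
Proof.
elim/big_ind2 : _ => //; first by rewrite Normc.normc1.
by move=> x1 x2 y1 y2 <- <-; rewrite Normc.normcM.
Qed.

Lemma normcX (x : R[i]) n : normc (x ^+ n) = normc x ^+ n.
Proof.
by elim: n => [|n IH]; rewrite ?Normc.normc1// !exprS Normc.normcM IH.
Qed.

Lemma normc_nat n : normc (n%:R : R[i]) = n%:R.
Proof. by rewrite normcMn Normc.normc1. Qed.

(** Only the constant term survives the sum: for 0 < i < M the powers of the
nontrivial root of unity [e ^+ i] form a geometric sum equal to 0. *)
Lemma sum_horner_unity_roots (P : {poly R[i]}) M : (size P <= M)%N -> (0 < M)%N ->
  \sum_(j < M) P.[cis (pi *+ 2 / M%:R) ^+ j] = M%:R * P.[0].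
Proof.
move=> sP M0; set e := cis _.
have M0R : M%:R != 0 :> R by rewrite pnatr_eq0 -lt0n.
have eM : e ^+ M = 1.
  by rewrite -cisMn -(mulr_natr (_ / _)) divfK// cis2pi.
have e1 (m : nat) : (0 < m < M)%N -> e ^+ m != 1.
  move=> /andP[m0 mM]; rewrite -cisMn cis_neq1// -(mulr_natr (_ / _)) mulrAC.
  have p2 : 0 < pi *+ 2 :> R by rewrite mulrn_wgt0// pi_gt0.
  rewrite divr_gt0 ?mulr_gt0 ?ltr0n//= ltr_pdivrMr ?ltr0n//.
  by rewrite ltr_pM2l// ltr_nat.
under eq_bigr do rewrite (horner_coef_wide _ sP).
rewrite exchange_big/= (bigD1 (Ordinal M0))//= [X in _ + X]big1 ?addr0 => [|i i0].
  under eq_bigr do rewrite expr0 mulr1.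
  by rewrite sumr_const card_ord horner_coef0 mulr_natl.
have {}i0 : (0 < i)%N by rewrite lt0n; apply: contra i0 => /eqP i0; exact/eqP/val_inj.
have ei : e ^+ i != 1 by rewrite e1// i0 ltn_ord.
rewrite -mulr_sumr; under eq_bigr do rewrite exprAC.
suff -> : \sum_(j < M) (e ^+ i) ^+ j = 0 by rewrite mulr0.
apply: (mulfI (_ : e ^+ i - 1 != 0)); first by rewrite subr_eq0.
by rewrite mulr0 -subrX1 exprAC eM expr1n subrr.
Qed.

(** The value at 0 is an average of values on the circle. *)
Lemma exists_cis_normc_ge (P : {poly R[i]}) :
  exists2 a : R, 0 <= a & normc P.[0] <= normc P.[cis a].
Proof.
set M := (size P).+1.
have := @sum_horner_unity_roots P M (leqnSn _) isT.
set e := (X in cis X) => eq.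
apply: contrapT => H.
have lt (j : 'I_M) : normc P.[cis e ^+ j] < normc P.[0].
  rewrite ltNge; apply/negP => h; apply: H; exists (e *+ j); last by rewrite cisMn.
  by rewrite mulrn_wge0// divr_ge0// mulrn_wge0// pi_ge0.
have : \sum_(j < M) normc P.[cis e ^+ j] < \sum_(j < M) normc P.[0].
  by apply: ltr_sum => //; apply/hasP; exists ord0; rewrite // mem_index_enum.
rewrite sumr_const card_ord ltNge -[_ *+ _]mulr_natl.
by rewrite -normc_nat -Normc.normcM -eq normc_sum.
Qed.

(** * Riemann sums of periodic continuous functions *)

Lemma continuous_integrable_itv (L : R -> R) (a b : R) : continuous L ->
  mu.-integrable `[a, b] (EFin \o L).
Proof.
move=> cL; apply: continuous_compact_integrable; first exact: segment_compact.
exact: continuous_subspaceT.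
Qed.

(** Compactness as near-covering: the property holds for all small [d] locally near
each point of the segment, hence for all small [d] on the whole segment. *)
Lemma segment_unif_continuous (L : R -> R) (a b : R) : continuous L ->
  forall e, 0 < e -> exists2 d, 0 < d &
    forall x y, a <= x <= b -> `|x - y| <= d -> L x <= L y + e.
Proof.
move=> cL e e0.
have /compact_near_coveringP cK := @segment_compact R a b.
pose P d x := forall y, `|x - y| <= d -> L x <= L y + e.
have : \forall d \near 0^'+, `[a, b] `<=` P d.
  apply: cK => x _.
  have /cvgrPdist_lt/(_ (e / 2)) := cL x; rewrite divr_gt0// => /(_ isT).
  case/nbhs_ballP => /= h h0 hL.
  exists (ball x (h / 2), ([set d | 0 < d] `&` [set d | d < h / 2])) => /=.
    split; first by apply: nbhsx_ballx; rewrite divr_gt0.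
    apply: filterI; [exact: nbhs_right_gt|apply: nbhs_right_lt; exact: divr_gt0].
  move=> -[x' d] /= [xx' [d0 dh]] y x'y.
  have h1 : `|L x - L x'| < e / 2.
    apply: hL; apply: le_ball xx'; rewrite ler_pdivrMr//; lra.
  have h2 : `|L x - L y| < e / 2.
    apply: hL; rewrite /ball/=; rewrite /ball/= in xx'.
    rewrite (le_lt_trans (ler_distD x' _ _))// [h]splitr.
    by rewrite ltrD// (le_lt_trans x'y).
  move: h1 h2; rewrite !ltr_distl => /andP[? ?] /andP[? ?]; lra.
move=> hP; have : \forall d \near 0^'+, (`[a, b] `<=` P d) /\ 0 < d.
  by apply: filterI => //; exact: nbhs_right_gt.
move=> /filter_ex[d [abP d0]].
by exists d => // x y xab; apply: abP; rewrite /= in_itv.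
Qed.

Lemma Rintegral_split (L : R -> R) (a b : R) : continuous L -> 0 <= a <= b ->
  \int[mu]_(x in `[0, b]) L x =
  \int[mu]_(x in `[0, a]) L x + \int[mu]_(x in `]a, b]) L x.
Proof.
move=> cL /andP[a0 ab]; rewrite -(@Rintegral_itvB _ L (BLeft 0) (BRight b) a) 1?addrC ?subrK//.
exact: continuous_integrable_itv.
Qed.

Lemma Rintegral_ge_cst (L : R -> R) (a b c : R) : continuous L -> a <= b ->
  (forall x, a <= x <= b -> c <= L x) -> (b - a) * c <= \int[mu]_(x in `]a, b]) L x.
Proof.
move=> cL ab cl.
have -> : (b - a) * c = \int[mu]_(x in `]a, b]) c.
  rewrite Rintegral_cst//= lebesgue_measure_itv/= lte_fin.
  by case: ltgtP ab => // [ab|->] _; rewrite /= ?subrr mulrC.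
apply: le_Rintegral => //.
- apply: (integrableS _ _ _ (continuous_integrable_itv (cst c) a b _)) => //.
    exact: subset_itv_oc_cc.
  exact: cst_continuous.
- apply: (integrableS _ _ _ (continuous_integrable_itv L a b _)) => //.
  exact: subset_itv_oc_cc.
- by move=> x /=; rewrite in_itv/= => /andP[ax xb]; apply: cl; rewrite (ltW ax) xb.
Qed.

(** The estimate is uniform in the shift [a], because the sum does not change when
[a] moves by the mesh T / N: it suffices to treat shifts smaller than the mesh,
for which each sample point lies in its own subinterval. *)
Lemma riemann_sum_le (L : R -> R) (T : R) : continuous L -> periodic L T -> 0 < T ->
  forall e, 0 < e -> exists2 N, (0 < N)%N & forall a, 0 <= a ->
    T / N%:R * \sum_(k < N) L (a + T / N%:R *+ k) <= \int[mu]_(x in `[0, T]) L x + T * e.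
Proof.
move=> cL pL T0 e e0.
have [d d0 hd] := segment_unif_continuous L 0 T cL e e0.
(* The mesh h = T / N is at most d. *)
pose N := (Num.truncn (T / d)).+1; have N0 : 0 < N%:R :> R by rewrite ltr0n.
pose h := T / N%:R; have h0 : 0 < h by rewrite divr_gt0.
have hN : h *+ N = T by rewrite -mulr_natr divfK// gt_eqF.
have hd' : h <= d.
  rewrite /h ler_pdivrMr// mulrC -ler_pdivrMr// ltW//; exact: truncnS_gt.
exists N => //; rewrite -/h.
pose S a := \sum_(k < N) L (a + h *+ k).
have pS : periodic S h.
  move=> a; rewrite /S /N big_ord_recr [in RHS]big_ord_recl/= mulr0n addr0 addrC.
  congr (_ + _); first by rewrite -addrA -mulrS hN pL.
  by apply: eq_bigr => i _; rewrite -addrA -mulrS.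
have wlog_small a : 0 <= a -> exists2 b, 0 <= b <= h & S a = S b.
  move=> a0; have ah : 0 <= a / h by rewrite divr_ge0// ltW.
  exists (a - h *+ Num.truncn (a / h)).
    have /andP[h1 h2] := truncn_itv ah.
    rewrite -(mulr_natr h) subr_ge0 lerBlDr mulrC -ler_pdivlMr// h1/=.
    rewrite -[X in _ <= X + _]mul1r -mulrDl -ler_pdivrMr// addrC.
    by rewrite -(natrD _ _ 1) addn1 ltW.
  by rewrite -[in LHS](subrK (h *+ Num.truncn (a / h)) a) periodicn.
move=> a /wlog_small[b /andP[b0 bh] Sab]; rewrite -/(S a) Sab.
have key n : (n <= N)%N ->
    h * \sum_(k < n) L (b + h *+ k) <= \int[mu]_(x in `[0, h *+ n]) L x + h *+ n * e.
  elim: n => [|n IH] nN.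
    by rewrite big_ord0 mulr0 mulr0n mul0r addr0 set_itv1 Rintegral_set1.
  have hn0 : 0 <= h *+ n by rewrite mulrn_wge0// ltW.
  have hnn : h *+ n <= h *+ n.+1 by rewrite mulrSr lerDl ltW.
  have hnT : h *+ n.+1 <= T by rewrite -hN ler_wpMn2l// ltW.
  rewrite big_ord_recr/= mulrDr (@Rintegral_split _ (h *+ n))//; last by rewrite hn0.
  have : (h *+ n.+1 - h *+ n) * (L (b + h *+ n) - e) <=
      \int[mu]_(x in `]h *+ n, h *+ n.+1]) L x.
    apply: Rintegral_ge_cst => // x /andP[x1 x2]; rewrite lerBlDr.
    rewrite mulrSr in x2 hnT.
    apply: hd; first by apply/andP; split; lra.
    by rewrite (le_trans _ hd')// ler_norml; apply/andP; split; lra.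
  have := IH (ltnW nN); rewrite mulrSr addrAC subrr add0r; lra.
by have := key N (leqnn _); rewrite hN.
Qed.

(** * A weak Jensen inequality *)

(** The standard inequality log |p(z)| <= mean of log |p|, with log |p| replaced by
a continuous majorant. This form is insensitive to zeros of [p] on the circle. *)
Lemma log_norm_poly_le_mean (p : {poly R[i]}) (z : R[i]) (r : R) (L : R -> R) :
  continuous L -> periodic L (pi *+ 2) ->
  (forall t, normc p.[z + r%:C * cis t] <= expR (L t)) -> p.[z] != 0 ->
  pi *+ 2 * ln (normc p.[z]) <= \int[mu]_(t in `[0, pi *+ 2]) L t.
Proof.
move=> cL pL pleL pz0.
have T0 : 0 < pi *+ 2 :> R by rewrite mulrn_wgt0// pi_gt0.
apply/ler_addgt0Pr => e' e'0; pose e := e' / (pi *+ 2).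
have e0 : 0 < e by rewrite divr_gt0.
have [N N0 hN] := riemann_sum_le L _ cL pL T0 e e0.
pose h : R := pi *+ 2 / N%:R.
pose P := \prod_(k < N) (p \Po (z%:P + (r%:C * cis (h *+ k)) *: 'X)).
have PE x : P.[x] = \prod_(k < N) p.[z + r%:C * cis (h *+ k) * x].
  by rewrite horner_prod; apply: eq_bigr => k _; rewrite horner_comp !hornerE.
have [a a0] := exists_cis_normc_ge P.
rewrite !PE; under eq_bigr do rewrite mulr0 addr0.
rewrite prodr_const card_ord normcX normc_prod => h1.
have pz : 0 < normc p.[z].
  by rewrite lt_def normc_ge0 andbT; apply: contra pz0 => /eqP/Normc.eq0_normc ->.
have : normc p.[z] ^+ N <= expR (\sum_(k < N) L (a + h *+ k)).
  rewrite (le_trans h1)// expR_sum; apply: ler_prod => k _.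
  by rewrite normc_ge0/= -mulrA -cisD (addrC (h *+ k)) pleL.
rewrite -ler_ln ?posrE ?exprn_gt0 ?expR_gt0// expRK lnXn// => h2.
have hE : e' = pi *+ 2 * e by rewrite mulrC divfK// gt_eqF.
rewrite hE; apply: le_trans (hN a a0); rewrite -/h.
have h0 : 0 < h by rewrite divr_gt0// ltr0n.
have -> : pi *+ 2 * ln (normc p.[z]) = h * (ln (normc p.[z]) *+ N).
  have -> : pi *+ 2 = h * N%:R by rewrite divfK// pnatr_eq0 -lt0n.
  by rewrite -[in RHS]mulr_natl mulrA.
by rewrite ler_pM2l.
Qed.

(** * The spectral radius of a two by two matrix *)

Implicit Types A : 'M[R[i]]_2.

Lemma eigenvalue2E A a : eigenvalue A a = (a ^+ 2 - \tr A * a + \det A == 0).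
Proof.
rewrite eigenvalue_root_char /root horner_coef size_char_poly.
rewrite !big_ord_recr big_ord0/= add0r expr0 mulr1 expr1.
have := char_poly_trace A isT; rewrite /= => ->.
rewrite char_poly_det sqrrN expr1n mul1r.
have := monicP (char_poly_monic A); rewrite /lead_coef size_char_poly /= => ->.
by congr (_ == 0); ring.
Qed.

Lemma spectral_radius2 A : exists l1 l2 : R[i],
  [/\ l1 + l2 = \tr A, l1 * l2 = \det A, spectral_radius A = normc l1 &
      normc l2 <= normc l1].
Proof.
have [[l1 + l1E] le] := spectral_radiusP A.
rewrite eigenvalue2E => /eqP h1; exists l1, (\tr A - l1); split => //.
- by rewrite addrC subrK.
- by rewrite -[RHS]subr0 -h1; ring.
- by rewrite l1E; apply: le; rewrite eigenvalue2E -h1; apply/eqP; ring.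
Qed.

(** The eigenvalues are 1 and [\det A]. *)
Lemma spectral_radius_eq1 A :
  \det (A - 1) = 0 -> normc (\det A) <= 1 -> spectral_radius A = 1.
Proof.
move=> h d1.
have {}h : 1 - \tr A + \det A = 0.
  rewrite -h !detmx2 /mxtrace !big_ord_recl big_ord0 !mxE/= addr0.
  have -> : lift ord0 ord0 = ord_max :> 'I_2 by exact/val_inj.
  by rewrite !subr0; ring.
have [_ le] := spectral_radiusP A; have [l1 [l2 [ht hd hl _]]] := spectral_radius2 A.
apply/le_anti/andP; split.
  have : (l1 - 1) * (l1 - \det A) = 0.
    transitivity (- l1 * (1 - \tr A + \det A)); last by rewrite h mulr0.
    by rewrite -ht -hd; ring.
  rewrite hl => /eqP; rewrite mulf_eq0 !subr_eq0 => /orP[/eqP ->|/eqP ->//].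
  by rewrite Normc.normc1.
rewrite -[X in X <= _](@Normc.normc1 R); apply: le.
by rewrite eigenvalue2E -h; apply/eqP; ring.
Qed.

Lemma parallelogram (a b : R[i]) :
  normc (a + b) ^+ 2 + normc (a - b) ^+ 2 = 2 * (normc a ^+ 2 + normc b ^+ 2).
Proof.
case: a b => [a1 a2] [b1 b2].
by rewrite /= !sqr_sqrtr ?addr_ge0 ?sqr_ge0//; ring.
Qed.

(** With l1, l2 the eigenvalues, [S] is |l1|^2 + |l2|^2 by the parallelogram law,
and S^2 - 4 |det|^2 is the square of |l1|^2 - |l2|^2. Hence the spectral radius
depends continuously on trace and determinant even where the eigenvalues
cannot be chosen continuously. *)
Lemma spectral_radius2E A :
  let S := (normc (\tr A) ^+ 2 + normc (\tr A ^+ 2 - \det A *+ 4)) / 2 in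
  spectral_radius A = Num.sqrt ((S + Num.sqrt (S ^+ 2 - 4 * normc (\det A) ^+ 2)) / 2).
Proof.
move=> S; have [l1 [l2 [ht hd -> le]]] := spectral_radius2 A.
have SE : S = normc l1 ^+ 2 + normc l2 ^+ 2.
  rewrite /S -ht -hd.
  have -> : (l1 + l2) ^+ 2 - (l1 * l2) *+ 4 = (l1 - l2) ^+ 2 by ring.
  by rewrite normcX parallelogram mulrC mulrA mulVf ?mul1r// pnatr_eq0.
have -> : S ^+ 2 - 4 * normc (\det A) ^+ 2 = (normc l1 ^+ 2 - normc l2 ^+ 2) ^+ 2.
  by rewrite SE -hd Normc.normcM; ring.
have l12 : 0 <= normc l1 ^+ 2 - normc l2 ^+ 2.
  by rewrite subr_ge0 ler_sqr ?nnegrE ?normc_ge0.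
rewrite sqrtr_sqr (ger0_norm l12) SE.
have -> : (normc l1 ^+ 2 + normc l2 ^+ 2 + (normc l1 ^+ 2 - normc l2 ^+ 2)) / 2 = normc l1 ^+ 2.
  by field.
by rewrite sqrtr_sqr ger0_norm// normc_ge0.
Qed.

(** Newton's recurrence a^(n+2) + b^(n+2) = s (a^(n+1) + b^(n+1)) - d (a^n + b^n)
makes the power sums of the eigenvalues polynomial in [z]. *)
Lemma power_sum_poly (s d : {poly R[i]}) n : exists p : {poly R[i]},
  forall z a b, a + b = s.[z] -> a * b = d.[z] -> p.[z] = a ^+ n + b ^+ n.
Proof.
suff [p [q [h _]]] : exists p q : {poly R[i]},
    (forall z a b, a + b = s.[z] -> a * b = d.[z] -> p.[z] = a ^+ n + b ^+ n) /\
    (forall z a b, a + b = s.[z] -> a * b = d.[z] -> q.[z] = a ^+ n.+1 + b ^+ n.+1).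
  by exists p.
elim: n => [|n [p [q [hp hq]]]].
  by exists 2%:P, s; split=> z a b; rewrite ?hornerE.
exists q, (s * q - d * p); split=> // z a b hs hd.
rewrite !hornerE (hp _ _ _ hs hd) (hq _ _ _ hs hd) -hs -hd !exprS; ring.
Qed.

(** Cancellation in x + y, for x = a^n and y = b^n, cannot also occur in x^2 + y^2:
if x + y is small then x^2 + y^2 = 2 x^2 - 2 x (x + y) + (x + y)^2 is close
to 2 x^2. So n or 2 n is a suitable exponent. *)
Lemma power_sum_ge (a b : R[i]) (n : nat) : exists2 m, (n <= m)%N &
  normc a ^+ m <= 2 * normc (a ^+ m + b ^+ m).
Proof.
have [h|h] := leP (normc a ^+ n) (2 * normc (a ^+ n + b ^+ n)); first by exists n.
exists (n * 2)%N; first by rewrite leq_pmulr.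
move: h; rewrite !exprM -normcX; move: (a ^+ n) (b ^+ n) => x y h.
have : normc ((x ^+ 2) *+ 2) <= normc (x ^+ 2 + y ^+ 2) + normc (x * (x + y) *+ 2)
      + normc ((x + y) ^+ 2).
  have -> : x ^+ 2 *+ 2 = (x ^+ 2 + y ^+ 2) + x * (x + y) *+ 2 - (x + y) ^+ 2 by ring.
  rewrite -(normcN ((x + y) ^+ 2)).
  by rewrite (le_trans (le_normcD _ _))// lerD2r le_normcD.
rewrite !normcMn (Normc.normcM x (x + y)) !normcX.
have := normc_ge0 (x + y); have := normc_ge0 x; move: h.
set X := normc x; set W := normc (x + y) => h X0 W0.
have h1 : 0 <= (X - 2 * W) * X by rewrite mulr_ge0// subr_ge0 ltW.
have h2 : 0 <= (X - 2 * W) * W by rewrite mulr_ge0// subr_ge0 ltW.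
have h3 : 0 <= W * W by rewrite mulr_ge0.
nra.
Qed.

(** * Continuity of the spectral radius *)

Lemma normc_continuous : continuous (@Normc.normc R : R[i]^o -> R).
Proof.
move=> z U /nbhs_ballP[e /= e0 hU].
apply/nbhs_ballP; exists (e%:C) => /=; first by rewrite ltcR.
move=> y; rewrite /ball/= => h; apply: hU.
have {}h : normc (z - y) < e by rewrite -ltcR.
have h1 := le_normcD (z - y) y; rewrite subrK in h1.
have h2 := le_normcD (y - z) z; rewrite subrK -opprB normcN in h2.
by rewrite /ball/= ltr_norml; apply/andP; split; lra.
Qed.

Lemma cvg_horner (K : numFieldType) (T : Type) (F : set_system T) (FF : Filter F)
    (f : T -> K) (a : K) (p : {poly K}) :
  f x @[x --> F] --> a -> p.[f x] @[x --> F] --> p.[a].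
Proof.
move=> fa; elim/poly_ind: p => [|p c IH].
  under eq_fun do rewrite horner0; rewrite horner0; exact: cvg_cst.
under eq_fun do rewrite hornerMXaddC; rewrite hornerMXaddC.
by apply: cvgD; [exact: cvgM|exact: cvg_cst].
Qed.

Lemma normc_horner_continuous (p : {poly R[i]}) :
  continuous (fun z : R[i]^o => normc p.[z]).
Proof.
move=> z; apply: (@continuous_comp _ _ _ (horner p : R[i]^o -> R[i]^o) (@Normc.normc R));
  last exact: normc_continuous.
exact: (@cvg_horner R[i] R[i]^o (nbhs z) (nbhs_filter z) id z p cvg_id).
Qed.

Definition eval_mx (A : 'M[{poly R[i]}]_2) (z : R[i]) := map_mx (horner_eval z) A.

Lemma trace_eval_mx (A : 'M[{poly R[i]}]_2) z : \tr (eval_mx A z) = (\tr A).[z].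
Proof. exact: trace_map_mx. Qed.

Lemma det_eval_mx (A : 'M[{poly R[i]}]_2) z : \det (eval_mx A z) = (\det A).[z].
Proof. exact: det_map_mx. Qed.

Lemma spectral_radius_eval_continuous (A : 'M[{poly R[i]}]_2) :
  continuous (fun z : R[i]^o => spectral_radius (eval_mx A z)).
Proof.
pose q := \tr A ^+ 2 - \det A *+ 4.
pose S (z : R[i]^o) := (normc (\tr A).[z] * normc (\tr A).[z] + normc q.[z]) / 2.
pose D (z : R[i]^o) := S z * S z - 4 * (normc (\det A).[z] * normc (\det A).[z]).
have srE z : spectral_radius (eval_mx A z) = Num.sqrt ((S z + Num.sqrt (D z)) / 2).
  have qE : q.[z] = (\tr A).[z] ^+ 2 - (\det A).[z] *+ 4.
    by rewrite hornerD hornerN hornerMn horner_exp.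
  by rewrite spectral_radius2E trace_eval_mx det_eval_mx -qE /D /S !expr2.
under eq_fun do rewrite srE.
suff cvgF (F : set_system R[i]) z : Filter F ->
    (forall p : {poly R[i]}, normc p.[x] @[x --> F] --> normc p.[z]) ->
    Num.sqrt ((S x + Num.sqrt (D x)) / 2) @[x --> F] --> Num.sqrt ((S z + Num.sqrt (D z)) / 2).
  by move=> z; apply: (cvgF _ _ (nbhs_filter z)) => p; exact: normc_horner_continuous.
move=> FF cn.
have cS : S x @[x --> F] --> S z.
  apply: cvgM; last exact: cvg_cst.
  by apply: cvgD; [apply: cvgM; exact: cn|exact: cn].
have cD : D x @[x --> F] --> D z.
  apply: cvgB; first by apply: cvgM; exact: cS.
  by apply: cvgM; [exact: cvg_cst|apply: cvgM; exact: cn].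
have csqrt (f : R[i] -> R) a : f x @[x --> F] --> a -> Num.sqrt (f x) @[x --> F] --> Num.sqrt a.
  by move=> fa; apply: continuous_cvg fa; exact: sqrt_continuous.
apply: (csqrt) => //; apply: cvgM; last exact: cvg_cst.
by apply: cvgD; [exact: cS|exact: csqrt].
Qed.

Lemma spectral_radius_ge0 (A : 'M[R[i]]_2) : 0 <= spectral_radius A.
Proof. by have [l1 [l2 [_ _ -> _]]] := spectral_radius2 A; exact: normc_ge0. Qed.

(** * Removing the regularization *)

(** The functions log C - log (u + 1/(n+1)), with C an upper bound of u + 1, are
nonnegative and increase to log C - log u, so monotone convergence applies. Their
integrals are bounded by hypothesis; hence log u is integrable even if [u]
vanishes somewhere, and its integral can be compared with [b]. *)
Lemma integral_lne_ge (u : R -> R) (T b : R) : continuous u -> (forall t, 0 <= u t) ->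
  0 < T ->
  (forall e, 0 < e -> T * b <= \int[mu]_(t in `[0, T]) ln (u t + e)) ->
  (b%:E <= (T^-1)%:E * \int[mu]_(t in `[0%R, T]) lne (u t)%:E)%E.
Proof.
move=> cu u0 T0 hb.
pose D : set R := `[0, T]%classic.
have [C C1 uC] : exists2 C, 1 <= C & forall t, D t -> u t + 1 <= C.
  have [c _ hc] := EVT_max (ltW T0) (continuous_subspaceT cu).
  exists (u c + 1); first by rewrite lerDr.
  by move=> t Dt; rewrite lerD2r hc// inE.
have C0 : 0 < C by lra.
pose v n t := ln C - ln (u t + n.+1%:R^-1).
pose f t := ((ln C)%:E - lne (u t)%:E)%E.
have un n t : 0 < u t + n.+1%:R^-1 :> R by rewrite ltr_wpDl// invr_gt0.
have cl e : 0 < e -> continuous (fun t => ln (u t + e)).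
  move=> e0 t; apply: (@continuous_comp _ _ _ (fun t => u t + e) (@ln R)).
    by apply: cvgD; [exact: cu|exact: cvg_cst].
  by apply: continuous_ln; rewrite ltr_wpDl.
have cv n : continuous (v n).
  by move=> t; apply: cvgB; [exact: cvg_cst|apply: cl; rewrite invr_gt0].
have mD : measurable (D : set (measurableTypeR R)) by exact: measurable_itv.
have iv n : mu.-integrable D (EFin \o v n).
  exact: continuous_integrable_itv.
have il e : 0 < e -> mu.-integrable D (EFin \o (fun t => ln (u t + e))).
  by move=> e0; apply: continuous_integrable_itv; exact: cl.
have v0 n t : D t -> (0 <= (v n t)%:E)%E.
  move=> Dt; rewrite lee_fin subr_ge0 ler_ln ?posrE ?un//.
  by rewrite (le_trans _ (uC t Dt))// lerD2l invf_le1// ler1n.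
have ndv t : D t -> nondecreasing_seq (fun n => (v n t)%:E).
  move=> Dt m n mn; rewrite lee_fin lerD2l lerN2 ler_ln ?posrE ?un//.
  by rewrite lerD2l lef_pV2 ?posrE// ler_nat.
have fE t : D t -> limn (fun n => (v n t)%:E) = f t.
  move=> Dt; apply/cvg_lim => //.
  have cw : (u t + n.+1%:R^-1) @[n --> \oo] --> u t.
    rewrite -[X in _ --> X]addr0; apply: cvgD; first exact: cvg_cst.
    exact: cvg_harmonic.
  have [ut0|ut0] := ltP 0 (u t).
    rewrite /f lne_EFin// -EFinB; apply: cvg_EFin; first by apply: nearW.
    apply: cvgB; first exact: cvg_cst.
    apply: continuous_cvg cw. exact: continuous_ln ut0.
  have {}ut0 : u t = 0 by apply/le_anti; rewrite ut0 u0.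
  rewrite /f ut0 le0_lneNy//= .
  apply/cvgeyPge => A.
  have := cw; rewrite ut0 => /cvgrPdist_lt/(_ (expR (ln C - A)) (expR_gt0 _)).
  apply: filterS => n /=; rewrite sub0r normrN add0r gtr0_norm ?invr_gt0// => hn.
  rewrite lee_fin /v ut0 add0r lerBrDl -lerBrDr.
  by rewrite -[leRHS]expRK ler_ln ?posrE ?invr_gt0 ?expR_gt0// ltW.
have intv n : (\int[mu]_(t in D) (v n t)%:E <= (T * (ln C - b))%:E)%E.
  have n0 : 0 < n.+1%:R^-1 :> R by rewrite invr_gt0.
  have fin := integrable_fin_num mD (iv n).
  rewrite -(fineK fin) lee_fin.
  rewrite -[leLHS]/(\int[mu]_(t in D) v n t)%R RintegralB//; last 2 first.
    - by apply: continuous_integrable_itv => t; exact: cst_continuous.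
    - exact: il.
  rewrite Rintegral_cst//= lebesgue_measure_itv/= lte_fin T0/= subr0.
  by have := hb _ n0; rewrite mulrBr mulrC; lra.
have intf : (\int[mu]_(t in D) f t <= (T * (ln C - b))%:E)%E.
  have -> : (\int[mu]_(t in D) f t = \int[mu]_(t in D) limn (fun n => (v n t)%:E))%E.
    by apply: eq_integral => t /[!inE] Dt; rewrite fE.
  have mv n := measurable_int mu (iv n).
  rewrite (monotone_convergence mu mD mv v0 ndv); apply: lime_le.
    apply: ereal_nondecreasing_is_cvgn => m n mn; apply: ge0_le_integral => //; try exact: v0.
    by move=> t Dt; exact: ndv.
  exact: nearW.
have f0 t : D t -> (0 <= f t)%E.
  by move=> Dt; rewrite -fE//; apply: lime_ge; [exact: ereal_nondecreasing_is_cvgn (ndv t Dt)|exact: nearW (fun n => v0 n t Dt)].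
have If : mu.-integrable D f.
  apply/integrableP; split.
    have mv n := measurable_int mu (iv n).
    apply: (measurable_realfun.emeasurable_fun_cvg _ _ mv) => t Dt.
    rewrite -fE//; exact: (ereal_nondecreasing_is_cvgn (ndv t Dt)).
  rewrite (_ : (\int[mu]_(t in D) `|f t| = \int[mu]_(t in D) f t)%E).
    exact: le_lt_trans intf (ltry _).
  by apply: eq_integral => t /[!inE] Dt; rewrite gee0_abs ?f0.
have -> : (\int[mu]_(t in D) lne (u t)%:E = (T * ln C)%:E - \int[mu]_(t in D) f t)%E.
  transitivity (\int[mu]_(t in D) ((ln C)%:E - f t))%E.
    apply: eq_integral => t _; rewrite /f; case: (lne _) => [r| |]//=.
    by rewrite -!EFinB opprB addrC subrK.
  rewrite integralB//.
    by rewrite integral_cst//= lebesgue_measure_itv/= lte_fin T0/= sube0 -EFinM mulrC.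
  by apply: continuous_integrable_itv => t; exact: cst_continuous.
have fin := integrable_fin_num mD If.
rewrite -(fineK fin) in intf *; rewrite lee_fin in intf.
rewrite -EFinB -EFinM lee_fin ler_pdivlMl//.
by move: intf; rewrite mulrBr; lra.
Qed.

(** Jensen's inequality for the logarithm in the form that is needed: integrate the
tangent line bound ln x <= ln c + x / c - 1. *)
Lemma integral_ge_of_log (u : R -> R) (T c : R) : continuous u -> (forall t, 0 <= u t) ->
  0 < T -> 0 < c ->
  (forall e, 0 < e -> T * ln c <= \int[mu]_(t in `[0, T]) ln (u t + e)) ->
  (c%:E <= (T^-1)%:E * \int[mu]_(t in `[0%R, T]) (u t)%:E)%E.
Proof.
move=> cu u0 T0 c0 hb.
have ic (f : R -> R) : continuous f -> mu.-integrable `[0, T] (EFin \o f).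
  exact: continuous_integrable_itv.
have iu := ic u cu.
have mD : measurable (`[0%R, T]%classic : set (measurableTypeR R)) by exact: measurable_itv.
have fin := integrable_fin_num mD iu.
rewrite -(fineK fin) -EFinM lee_fin ler_pdivlMl//.
rewrite -[leRHS]/(\int[mu]_(t in `[0, T]) u t)%R.
apply/ler_addgt0Pr => e' e'0; pose e := e' / T.
have e0 : 0 < e by rewrite divr_gt0.
have -> : e' = T * e by rewrite mulrC divfK// gt_eqF.
have cl : continuous (fun t => ln (u t + e)).
  move=> t; apply: (@continuous_comp _ _ _ (fun t => u t + e) (@ln R)).
    by apply: cvgD; [exact: cu|exact: cvg_cst].
  by apply: continuous_ln; rewrite ltr_wpDl.
pose g t := c^-1 * u t + (ln c - 1 + c^-1 * e).
have cg1 : continuous (fun t => c^-1 * u t).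
  by move=> t; apply: cvgM; [exact: cvg_cst|exact: cu].
have cg : continuous g.
  by move=> t; apply: cvgD; [exact: cg1|exact: cvg_cst].
have lg t : ln (u t + e) <= g t.
  have ue : 0 < u t + e by rewrite ltr_wpDl.
  have : ln (1 + ((u t + e) / c - 1)) <= (u t + e) / c - 1.
    by apply: le_ln1Dx; rewrite ltrBrDl subrr divr_gt0.
  by rewrite addrC subrK ln_div ?posrE// /g; lra.
have := le_trans (hb e e0) (le_Rintegral mD (ic _ cl) (ic _ cg) (fun t _ => lg t)).
rewrite RintegralD//; [|exact: ic|by apply: ic => t; exact: cst_continuous].
rewrite RintegralZl// Rintegral_cst//= lebesgue_measure_itv/= lte_fin T0/= subr0.
set I := Rintegral _ _ _ => h.
have : 0 <= c^-1 * (I + T * e - c * T).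
  have -> : c^-1 * (I + T * e - c * T) = c^-1 * I + c^-1 * e * T - T.
    by field; rewrite gt_eqF.
  lra.
by rewrite pmulr_rge0 ?invr_gt0// subr_ge0 mulrC.
Qed.

(** * Subharmonicity *)

Lemma circle_continuous (z : R[i]) (r : R) :
  continuous (fun t : R => z + r%:C * cis t : R[i]^o).
Proof.
move=> t0 U /nbhs_ballP[e /= e0 hU].
pose g t := `|r| * Num.sqrt ((cos t0 - cos t) * (cos t0 - cos t) +
                             (sin t0 - sin t) * (sin t0 - sin t)).
have gE t : normc (z + r%:C * cis t0 - (z + r%:C * cis t)) = g t.
  rewrite opprD addrACA subrr add0r -mulrBr Normc.normcM /g -!expr2.
  by congr (_ * _); rewrite /= expr0n/= addr0 sqrtr_sqr.
have g0 : g t @[t --> t0] --> 0.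
  have -> : 0 = g t0 by rewrite /g !subrr !mulr0 addr0 sqrtr0 mulr0.
  apply: cvgM; first exact: cvg_cst.
  apply: (@continuous_cvg _ _ _ _ _ _ Num.sqrt); first exact: sqrt_continuous.
  have cc : cos t @[t --> t0] --> cos t0 by exact: continuous_cos.
  have cs : sin t @[t --> t0] --> sin t0 by exact: continuous_sin.
  by apply: cvgD; apply: cvgM; apply: cvgB => //; exact: cvg_cst.
have eE : e = (complex.Re e)%:C by rewrite [LHS]complexE (ger0_Im (ltW e0)) mulr0 addr0.
have re0 : 0 < complex.Re e by rewrite -ltcR -eE.
have /cvgrPdist_lt/(_ _ re0) := g0; apply: filterS => t.
rewrite sub0r normrN => h; apply: hU; rewrite /ball/= eE.
have -> : `|z + r%:C * cis t0 - (z + r%:C * cis t)| =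
  (normc (z + r%:C * cis t0 - (z + r%:C * cis t)))%:C :> R[i] by [].
by rewrite ltcR gE (le_lt_trans (ler_norm _)).
Qed.

Lemma continuous_along_circle (f : R[i] -> R) (z : R[i]) (r : R) :
  continuous (f : R[i]^o -> R) -> continuous (fun t => f (z + r%:C * cis t)).
Proof.
move=> cf t.
apply: (@continuous_comp _ R[i]^o _ (fun t : R => z + r%:C * cis t : R[i]^o)).
  exact: circle_continuous.
exact: cf.
Qed.

Lemma subharmonic_of_log_le_mean (f : R[i] -> R) :
  continuous (f : R[i]^o -> R) -> (forall z, 0 <= f z) ->
  (forall z r e, 0 < e -> 0 < f z ->
    pi *+ 2 * ln (f z) <= \int[mu]_(t in `[0, pi *+ 2]) ln (f (z + r%:C * cis t) + e)) ->
  subharmonic (fun z => (f z)%:E) /\ subharmonic (fun z => lne (f z)%:E).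
Proof.
move=> cf f0 logf.
have T0 : 0 < pi *+ 2 :> R by rewrite mulrn_wgt0// pi_gt0.
have cu z r : continuous (fun t => f (z + r%:C * cis t)).
  exact: continuous_along_circle.
have circE (z : R[i]) (r t : R) : z + (r * cos t +i* (r * sin t)) = z + r%:C * cis t.
  by congr (_ + _); apply/eqP; rewrite eq_complex/= !mul0r subr0 addr0 !eqxx.
have nearlt z (b : R) : f z < b -> \forall y \near (z : R[i]^o), f y < b.
  by move=> zb; have := cf z [set c | c < b]; apply; exact: lt_nbhsl zb.
split; split.
- by move=> z; rewrite ltry.
- move=> z a /=; rewrite lte_fin ltrNr => /nearlt h.
  by exists [set y | f y < - a] => // y /=; rewrite lte_fin ltrNr.
- move=> z r _; under eq_integral do rewrite circE.
  rewrite mulr_natl; have [z0|z0] := ltP 0 (f z); last first.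
    have -> : f z = 0 by apply/le_anti; rewrite z0 f0.
    apply: mule_ge0; first by rewrite lee_fin invr_ge0 ltW.
    by apply: integral_ge0 => t _; rewrite lee_fin.
  apply: integral_ge_of_log => // e e0; exact: logf.
- by move=> z; rewrite /=; case: ifP; rewrite ?ltNyr ?ltry.
- have lneE y a : (a%:E < - lne (f y)%:E)%E = (f y < expR (- a)).
    rewrite lteNr -EFinN /=; case: ifPn => y0.
      by rewrite ltNyr (le_lt_trans y0)// expR_gt0.
    by rewrite lte_fin -[X in _ < X]expRK ltr_ln ?posrE ?expR_gt0// ltNge.
  move=> z a; rewrite lneE => /nearlt h.
  by exists [set y | f y < expR (- a)] => // y; rewrite lneE.
- move=> z r _; under eq_integral do rewrite circE.
  rewrite mulr_natl; have [z0|z0] := ltP 0 (f z); last first.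
    by rewrite le0_lneNy ?lee_fin// leNye.
  rewrite lne_EFin//.
  apply: integral_lne_ge => // e e0; exact: logf.
Qed.

Section Family.
Variable A : 'M[{poly R[i]}]_2.
Local Notation rho_A z := (spectral_radius (eval_mx A z)).

(** The power sums p of the eigenvalues turn log |p| <= log 2 + m log (rho_A + e) on
the circle into m (log rho_A(z) - mean) <= 2 log 2 for arbitrarily large m. *)
Lemma log_spectral_radius_le_mean (z : R[i]) (r e : R) : 0 < e -> 0 < rho_A z ->
  pi *+ 2 * ln (rho_A z) <=
  \int[mu]_(t in `[0, pi *+ 2]) ln (rho_A (z + r%:C * cis t) + e).
Proof.
move=> e0 rz; pose u t := rho_A (z + r%:C * cis t) + e.
have T0 : 0 < pi *+ 2 :> R by rewrite mulrn_wgt0// pi_gt0.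
have u0 t : 0 < u t by exact: ltr_wpDl (spectral_radius_ge0 _) e0.
have cu : continuous u.
  move=> t; apply: cvgD; last exact: cvg_cst.
  apply: (continuous_along_circle (fun x => rho_A x)).
  exact: spectral_radius_eval_continuous.
have clu : continuous (fun t => ln (u t)).
  by move=> t; apply: (@continuous_comp _ _ _ u (@ln R)); [exact: cu|exact: continuous_ln].
rewrite -/(\int[mu]_(t in `[0, pi *+ 2]) ln (u t)); set I := Rintegral _ _ _.
have key n : exists2 m, (n <= m)%N &
    m%:R * (pi *+ 2 * ln (rho_A z) - I) <= 2 * (pi *+ 2 * ln 2).
  have [l1 [l2 [h1 h2 h3 _]]] := spectral_radius2 (eval_mx A z).
  have [m nm hm] := power_sum_ge l1 l2 n; exists m => //.
  have [p hp] := power_sum_poly (\tr A) (\det A) m.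
  rewrite trace_eval_mx in h1; rewrite det_eval_mx in h2.
  rewrite -(hp z _ _ h1 h2) -h3 -/(rho_A z) in hm.
  pose L t := ln 2 + m%:R * ln (u t).
  have cL : continuous L.
    move=> t; apply: cvgD; first exact: cvg_cst.
    by apply: cvgM; [exact: cvg_cst|exact: clu].
  have pL : periodic L (pi *+ 2).
    by move=> t; rewrite /L /u cisD cis2pi mulr1.
  have pleL t : normc p.[z + r%:C * cis t] <= expR (L t).
    have [a [b [k1 k2 k3 k4]]] := spectral_radius2 (eval_mx A (z + r%:C * cis t)).
    rewrite trace_eval_mx in k1; rewrite det_eval_mx in k2.
    rewrite (hp _ _ _ k1 k2) expRD lnK ?posrE// expRM_natl lnK ?posrE//.
    rewrite (le_trans (le_normcD _ _))// !normcX mulr_natl mulr2n.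
    have au : normc a <= u t by rewrite -k3 lerDl ltW.
    by rewrite lerD// lerXn2r ?nnegrE ?normc_ge0 ?(ltW (u0 t))// (le_trans k4).
  have pz0 : 0 < normc p.[z].
    by have := exprn_gt0 m rz; lra.
  have := log_norm_poly_le_mean p z r L cL pL pleL.
  have pz : p.[z] != 0.
    by apply: contraTneq pz0 => ->; rewrite Normc.normc0 ltxx.
  move=> /(_ pz).
  have ic (f : R -> R) : continuous f -> mu.-integrable `[0, pi *+ 2] (EFin \o f).
    exact: continuous_integrable_itv.
  rewrite RintegralD//; last 2 first.
    - by apply: ic => t; exact: cst_continuous.
    - by apply: ic => t; apply: cvgM; [exact: cvg_cst|exact: clu].
  rewrite RintegralZl//; last exact: ic.
  rewrite Rintegral_cst//= lebesgue_measure_itv/= lte_fin T0/= subr0 -/I.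
  have : ln (rho_A z ^+ m) <= ln (2 * normc p.[z]).
    by rewrite ler_ln ?posrE ?exprn_gt0 ?mulr_gt0.
  rewrite lnXn// lnM ?posrE// -mulr_natl => a1 a2.
  have a3 := ler_wpM2l (ltW T0) a1.
  rewrite mulrDr in a3; rewrite mulrBr mulrCA; lra.
rewrite leNgt; apply/negP => lt; have lt0 : 0 < pi *+ 2 * ln (rho_A z) - I by rewrite subr_gt0.
have [m nm] := key (Num.truncn (2 * (pi *+ 2 * ln 2) / (pi *+ 2 * ln (rho_A z) - I))).+1.
apply/negP; rewrite -ltNge -ltr_pdivrMr//.
by rewrite (lt_le_trans (truncnS_gt _))// ler_nat.
Qed.

Lemma spectral_radius_subharmonic :
  subharmonic (fun z => (rho_A z)%:E) /\ subharmonic (fun z => lne (rho_A z)%:E).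
Proof.
apply: subharmonic_of_log_le_mean.
- exact: spectral_radius_eval_continuous.
- by move=> z; exact: spectral_radius_ge0.
- by move=> z r e; exact: log_spectral_radius_le_mean.
Qed.

End Family.

(** * Positive braids *)

Lemma burau_atE (w : Br3) (z : R[i]) :
  burau_at w z = eval_mx (map_mx (map_poly intr) (burau_poly w)) z.
Proof. by rewrite /eval_mx -map_mx_comp. Qed.

Lemma det_ceval (B : 'M[{poly int}]_2) (z : R[i]) :
  \det (map_mx (fun p => ceval p z) B) = ceval (\det B) z.
Proof.
have -> : map_mx (fun p => ceval p z) B = map_mx (horner_eval z) (map_mx (map_poly intr) B).
  by rewrite -map_mx_comp.
by rewrite det_map_mx; congr horner; exact: det_map_mx.
Qed.

Lemma det_burau_at (w : Br3) (z : R[i]) : positive_braid w ->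
  exists n, \det (burau_at w z) = (- z) ^+ n.
Proof.
case=> s ->; exists (size s); rewrite /burau_at burau_poly_prod_sigma det_ceval.
have -> : \det (\prod_(i <- s) burau_gen ('X : {poly int}) i) = (- 'X) ^+ size s.
  elim: s => [|i s IH]; first by rewrite big_nil det1.
  by rewrite big_cons -[_ * _]/(_ *m _) det_mulmx IH det_burau_gen exprS.
by rewrite /ceval rmorphXn rmorphN/= map_polyX horner_exp !hornerE.
Qed.

(** Unless the Alexander polynomial is 0, its normalization by a nonzero constant
term excludes the root 0, at which the powers of t cleared below vanish. *)
Lemma det_burau_at_sub1 (w : Br3) (z : R[i]) : positive_braid w ->
  Zset R w z -> \det (burau_at w z - 1) = 0.
Proof.
move=> pw; rewrite /Zset /=; set p := alexander_poly w => pz0.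
pose D := \det (burau_poly w - 1).
have cM : {morph (fun q => ceval q z) : a b / a * b}.
  by move=> a b; rewrite /ceval rmorphM hornerM.
have -> : \det (burau_at w z - 1) = ceval D z.
  rewrite -det_ceval; congr (\det _); apply/matrixP => i j.
  by rewrite !mxE /ceval rmorphB/= hornerD hornerN rmorph_nat hornerMn hornerC.
have DE : \det (burau w - 1) = tofrac D.
  have -> : burau w - 1 = map_mx (@tofrac {poly int}) (burau_poly w - 1).
    rewrite -{1}(burau_polyP pw); apply/matrixP => i j; rewrite !mxE tofracB.
    by case: (i == j); rewrite ?tofrac1 ?tofrac0.
  by rewrite det_map_mx.
have [p0 [e [k pE]]] := alexander_polyP w; rewrite -/p in p0 pE.
(* Negative powers of t go to the left-hand side. *)
have cleared : exists a b : nat, p * cyclo3 'X * 'X^a = (-1) ^+ e * 'X^b * D.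
  have q0 := cyclo3_neq0.
  have qE : tofrac (cyclo3 'X) = cyclo3 tvar :> Qt.
    by rewrite /cyclo3 !tofracD tofracXn tofrac1.
  have t0 := tvar_neq0.
  have eq0 : tofrac p * cyclo3 tvar = (-1) ^+ e * tvar ^ k * tofrac D.
    by rewrite pE /alexander DE -[LHS]mulrA (mulfVK q0).
  have of_frac a b : tofrac p * cyclo3 tvar * tvar ^+ a = (-1) ^+ e * tvar ^+ b * tofrac D ->
      p * cyclo3 'X * 'X^a = (-1) ^+ e * 'X^b * D.
    move=> h; apply: (can_inj tofracK).
    rewrite (tofracM (p * _)).
    rewrite (tofracM p) qE.
    rewrite (tofracM _ D) tofracM.
    by rewrite !tofracXn tofracN tofrac1.
  move: eq0; case: k {pE} => n eq0.
    exists 0%N, n; apply: of_frac.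
    by rewrite eq0 expr0 mulr1.
  exists n.+1, 0%N; apply: of_frac.
  rewrite eq0 NegzE -exprnN expr0 mulr1 [LHS]mulrAC.
  by rewrite (mulfVK (expf_neq0 n.+1 t0)).
have [a [b eq]] := cleared.
have [p_eq0|p_neq0] := eqVneq p 0.
  move/eqP: eq; rewrite p_eq0 !mul0r eq_sym !mulf_eq0 signr_eq0 expf_eq0 polyX_eq0 andbF/=.
  by move=> /eqP ->; rewrite /ceval rmorph0 horner0.
have z0 : z != 0.
  apply: contra_neq p_neq0 => z0; case: p0 => // /negP[].
  by move: pz0; rewrite /ceval z0 horner_coef0 coef_map => /eqP; rewrite intr_eq0.
have cX (c : nat) : ceval 'X^c z = z ^+ c.
  by rewrite /ceval map_polyXn hornerXn.
have := congr1 (fun q => ceval q z) eq; rewrite /= !cM pz0 !mul0r cX => /eqP.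
rewrite eq_sym !mulf_eq0 expf_eq0 (negPf z0) andbF orbF => /orP[|/eqP//].
by rewrite /ceval rmorphXn rmorphN rmorph1 horner_exp hornerN hornerC expf_eq0 oppr_eq0 oner_eq0 andbF.
Qed.

Lemma rho_eq1_of_alexander_root (w : Br3) : positive_braid w ->
  Zset R w `&` closed_unit_disc R `<=` Rset R w.
Proof.
move=> pw z [rz dz]; split=> //.
apply: spectral_radius_eq1; first exact: det_burau_at_sub1.
have [n ->] := det_burau_at w z pw; rewrite normcX normcN exprn_ile1 ?normc_ge0//.
by rewrite -lecR.
Qed.

End SpectralRadius.

Theorem lemma4p2 (R : realType) (w : Br3) (hw : positive_braid w) :
  [/\ Zset R w `&` closed_unit_disc R `<=` Rset R w,
      continuous (rho w : R[i]^o -> R),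
      subharmonic (fun z : R[i] => (rho w z)%:E) &
      subharmonic (fun z : R[i] => lne (rho w z)%:E)].
Proof.
pose A : 'M[{poly R[i]}]_2 := map_mx (map_poly intr) (burau_poly w).
have rhoE : rho w = (fun z : R[i] => spectral_radius (eval_mx R A z)).
  by apply/funext => z; rewrite /rho burau_atE.
have [sub logsub] := spectral_radius_subharmonic R A.
split; first exact: rho_eq1_of_alexander_root.
- by rewrite rhoE; exact: spectral_radius_eval_continuous.
- by rewrite rhoE.
- by rewrite rhoE.
Qed.
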